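(* Let $G=\mathrm{Gal}(\bar{\mathbb{Q}}/\mathbb{Q})$ and let $H=\mathrm{Gal}(\bar{\mathbb{Q}}/K)$ be a finite index normal subgroup of $G$, where $K\subset\bar{\mathbb Q}$ is a finite Galois extension of $\mathbb{Q}$. Suppose there exists a set of coset representatives $\{s_i\}_i$ of $H$ in $G$ which forms a multiplicatively closed subset of $G$. If a finite group $M$ is realizable as a Galois group over $\mathbb{Q}$ through a Galois representation $(\pi,W)$ such that $M\cong\tilde\pi(G)=\tilde\pi(H)$, then $M\rtimes G/H$ is realizable as a Galois group over $\mathbb{Q}$, where the semidirect product law is the one obtained by identifying $M$ with $\tilde\rho(H)$, $\rho=\mathrm{Ind}_H^G(\pi|_H)$, and letting $s_iH\in G/H$ act on $\tilde\rho(H)$ by conjugation by $\tilde\rho(s_i)$.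
   Context: Let $E$ be a number field, $\Lambda$ a prime of its ring of integers, $E_\Lambda$ the completion, $\mathcal{O}_\Lambda$ its ring of integers, $\mathbb{F}_\Lambda$ its residue field. A Galois representation $(\pi,W)$ is an $m$-dimensional $E_\Lambda$-vector space $W$ with a continuous homomorphism $\pi:G\to\mathrm{GL}(W)$; a basis $w_1,\dots,w_m$ of $W$ is chosen so that $\pi(G)\subset \mathrm{GL}_m(\mathcal{O}_\Lambda)$, and $\tilde\pi:G\to\mathrm{PGL}_m(\mathbb{F}_\Lambda)$ is obtained by reduction modulo $\Lambda$ followed by passage to the projective group. A finite group $C$ is realizable as a Galois group over $\mathbb{Q}$ through $(\pi,W)$ if $C\cong\mathrm{Image}(\tilde\pi)$. With $n=[G:H]$, the induced representation $\rho=\mathrm{Ind}_H^G(\pi|_H)$ acts on $V=\{f:G\to W \mid f(hg)=\pi(h)f(g)\ \forall h\in H,g\in G\}$ by $(\rho(g)f)(x)=f(xg)$. For representatives $s_1=1,\dots,s_n$ of $H\backslash G$, $V$ has basis $\phi_{s_i,w_j}$, where $\phi_{s,w}(g)=\pi(gs^{-1})w$ if $gs^{-1}\in H$ and $0$ otherwise; in this basis $\rho(G)\subset\mathrm{GL}_{nm}(\mathcal{O}_\Lambda)$, and $\tilde\rho:G\to\mathrm{PGL}_{nm}(\mathbb{F}_\Lambda)$ is defined from $\rho$ as $\tilde\pi$ is from $\pi$. One has $\tilde\rho(H)\cong\tilde\pi(H)$, and $1\to\tilde\rho(H)\to\tilde\rho(G)\to G/H\to1$, $\tilde\rho(g)\mapsto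 gH$, is exact. *)

(* Defs.v *)
From HB Require Import structures.
From mathcomp Require Import all_boot all_order all_fingroup all_algebra all_field.
From mathcomp Require Import all_classical topology.

Set Implicit Arguments.
Unset Strict Implicit.
Unset Printing Implicit Defensive.

Import Order.TTheory GRing.Theory Num.Theory.
Local Open Scope ring_scope.
Local Open Scope quotient_scope.

HB.mixin Record isNormalClosed (G : groupType) (S : {pred G}) := {
  gpredJr : forall x y : G, x \in S -> (x ^ y)%g \in S
}.

#[short(type="normalClosed")]
HB.structure Definition NormalClosed (G : groupType) :=
  {S of GroupClosed G S & isNormalClosed G S}.

Section GroupQuotient.
Local Open Scope group_scope.
Variables (G : groupType) (N : normalClosed G).
Local Notation repr := generic_quotient.repr.

Definition gequiv (x y : G) : bool := x * y^-1 \in N.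

Lemma gequiv_is_equiv : equiv_class_of gequiv.
Proof.
split=> [x|x y|y x z]; rewrite /gequiv ?divgg ?gpred1 //.
  by rewrite -gpredV invgF.
by move=> xy yz; rewrite -(mulgVK y x) -mulgA gpredM.
Qed.

Canonical gequiv_equiv := EquivRelPack gequiv_is_equiv.
Canonical gequiv_encModRel := defaultEncModRel gequiv.

Definition gquot := {eq_quot gequiv}.
HB.instance Definition _ : EqQuotient G gequiv gquot := EqQuotient.on gquot.
HB.instance Definition _ := Choice.on gquot.

Definition gpi (x : G) : gquot := \pi x.

Lemma gpiP x y : gpi x = gpi y <-> x * y^-1 \in N.
Proof.
rewrite /gpi; split=> [/eqP|xy]; first by rewrite piE.
by apply/eqP; rewrite piE.
Qed.

Lemma gpi_repr (q : gquot) : gpi (repr q) = q.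
Proof. exact: reprK. Qed.

Definition gquot_one : gquot := gpi 1.
Definition gquot_mul (p q : gquot) : gquot := gpi (repr p * repr q).
Definition gquot_inv (p : gquot) : gquot := gpi (repr p)^-1.

Lemma gpiM x y : gpi (x * y) = gquot_mul (gpi x) (gpi y).
Proof.
apply/gpiP; rewrite invgM !mulgA.
have /gpiP := gpi_repr (gpi x); have /gpiP := gpi_repr (gpi y).
set x' := repr (gpi x); set y' := repr (gpi y) => yy' xx'.
have {}yy' : y * y'^-1 \in N by rewrite -gpredV invgM invgK.
have {}xx' : x * x'^-1 \in N by rewrite -gpredV invgM invgK.
have -> : x * y * y'^-1 * x'^-1 = (y * y'^-1) ^ x^-1 * (x * x'^-1).
  by rewrite conjgE invgK !mulgA mulgVK.
by rewrite gpredM // gpredJr.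
Qed.

Lemma gpiV x : gpi x^-1 = gquot_inv (gpi x).
Proof.
apply/gpiP; rewrite invgK.
have /gpiP := gpi_repr (gpi x); set x' := repr _ => xx'.
have -> : x^-1 * x' = (x' * x^-1) ^ x by rewrite conjgE mulgVK.
exact: gpredJr.
Qed.

Lemma gquot_mulA : associative gquot_mul.
Proof.
move=> p q r; rewrite -(gpi_repr p) -(gpi_repr q) -(gpi_repr r).
by rewrite -!gpiM mulgA.
Qed.
Lemma gquot_mul1g : left_id gquot_one gquot_mul.
Proof. by move=> p; rewrite -(gpi_repr p) -gpiM mul1g. Qed.
Lemma gquot_mulg1 : right_id gquot_one gquot_mul.
Proof. by move=> p; rewrite -(gpi_repr p) -gpiM mulg1. Qed.
Lemma gquot_mulVg : left_inverse gquot_one gquot_inv gquot_mul.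
Proof. by move=> p; rewrite -(gpi_repr p) -gpiV -gpiM mulVg. Qed.
Lemma gquot_mulgV : right_inverse gquot_one gquot_inv gquot_mul.
Proof. by move=> p; rewrite -(gpi_repr p) -gpiV -gpiM mulgV. Qed.

HB.instance Definition _ := isGroup.Build gquot
  gquot_mulA gquot_mul1g gquot_mulg1 gquot_mulVg gquot_mulgV.

Lemma gpi_morph : {morph gpi : x y / x * y}.
Proof. exact: gpiM. Qed.

End GroupQuotient.

Section SemidirectProduct.
Local Open Scope group_scope.

Record autAction (Q A : groupType) := AutAction {
  aact :> Q -> A -> A;
  aact1 : forall a, aact 1 a = a;
  aactM : forall p q a, aact (p * q) a = aact p (aact q a);
  aact_morph : forall q, {morph aact q : a b / a * b}
}.

Variables (Q A : groupType) (act : autAction Q A).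

(* The semidirect product A ><| Q, with law
   (a, p)(b, q) = (a (p . b), p q). *)
Definition semidirect of autAction Q A : Type := (A * Q)%type.
Local Notation S := (semidirect act).

HB.instance Definition _ := Choice.copy S (A * Q)%type.

Definition sd_one : S := (1, 1).
Definition sd_mul (x y : S) : S := (x.1 * act x.2 y.1, x.2 * y.2).
Definition sd_inv (x : S) : S := (act x.2^-1 x.1^-1, x.2^-1).

Lemma aactg1 q : act q 1 = 1.
Proof. by apply: (mulgI (act q 1)); rewrite -aact_morph !mulg1. Qed.

Lemma sd_mulA : associative sd_mul.
Proof.
by move=> x y z; rewrite /sd_mul /= aact_morph aactM !mulgA.
Qed.
Lemma sd_mul1g : left_id sd_one sd_mul.
Proof. by case=> a q; rewrite /sd_mul /= aact1 !mul1g. Qed.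
Lemma sd_mulg1 : right_id sd_one sd_mul.
Proof. by case=> a q; rewrite /sd_mul /= aactg1 !mulg1. Qed.
Lemma sd_mulVg : left_inverse sd_one sd_inv sd_mul.
Proof. by case=> a q; rewrite /sd_mul /= -aact_morph !mulVg aactg1. Qed.
Lemma sd_mulgV : right_inverse sd_one sd_inv sd_mul.
Proof. by case=> a q; rewrite /sd_mul /= -aactM mulgV aact1 mulgV. Qed.

HB.instance Definition _ := isGroup.Build S
  sd_mulA sd_mul1g sd_mulg1 sd_mulVg sd_mulgV.

End SemidirectProduct.

Definition iso_onto (A B : groupType) (f : A -> B) (S : set B) : Prop :=
  [/\ {morph f : x y / (x * y)%g}, injective f & range f = S].

(* algC is an algebraic closure of Q, all of whose ring automorphisms fix Q
   (fmorph_rat). *)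
Record absGal := AbsGal {
  aut_fun :> {rmorphism algC -> algC};
  aut_inv : {rmorphism algC -> algC};
  aut_funK : cancel aut_fun aut_inv;
  aut_invK : cancel aut_inv aut_fun
}.

Lemma absGalP (g h : absGal) : g =1 h -> g = h.
Proof.
case: g h => [g g' gK g'K] [h h' hK h'K] /= gh.
have eq_rm (f1 f2 : {rmorphism algC -> algC}) : f1 =1 f2 -> f1 = f2.
  case: f1 f2 => [f1 [[a1] [m1]]] [f2 [[a2] [m2]]] /= /funext f12.
  case: f2 / f12 a2 m2 => a2 m2.
  by rewrite (Prop_irrelevance a1 a2) (Prop_irrelevance m1 m2).
have {}gh := eq_rm _ _ gh; case: h / gh hK h'K => hK h'K.
have gh' : g' = h' by apply: eq_rm => x; rewrite -[x in LHS]h'K gK.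
case: h' / gh' hK h'K => hK h'K.
by rewrite (Prop_irrelevance gK hK) (Prop_irrelevance g'K h'K).
Qed.

HB.instance Definition _ := gen_eqMixin absGal.
HB.instance Definition _ := gen_choiceMixin absGal.

Definition absGal_one : absGal :=
  @AbsGal idfun idfun (fun=> erefl) (fun=> erefl).
Definition absGal_mul (g h : absGal) : absGal :=
  @AbsGal (g \o h) (aut_inv h \o aut_inv g)
    (can_comp (aut_funK g) (aut_funK h)) (can_comp (aut_invK h) (aut_invK g)).
Definition absGal_inv (g : absGal) : absGal :=
  AbsGal (aut_invK g) (aut_funK g).

Lemma absGal_mulA : associative absGal_mul.
Proof. by move=> g h k; apply: absGalP. Qed.
Lemma absGal_mul1g : left_id absGal_one absGal_mul.
Proof. by move=> g; apply: absGalP. Qed.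
Lemma absGal_mulg1 : right_id absGal_one absGal_mul.
Proof. by move=> g; apply: absGalP. Qed.
Lemma absGal_mulVg : left_inverse absGal_one absGal_inv absGal_mul.
Proof. by move=> g; apply: absGalP => x /=; rewrite aut_funK. Qed.
Lemma absGal_mulgV : right_inverse absGal_one absGal_inv absGal_mul.
Proof. by move=> g; apply: absGalP => x /=; rewrite aut_invK. Qed.

HB.instance Definition _ := isGroup.Build absGal
  absGal_mulA absGal_mul1g absGal_mulg1 absGal_mulVg absGal_mulgV.

(* The Krull topology: pointwise convergence for the discrete topology on algC;
   a basic neighbourhood of g fixes the values of g on a finite set, i.e. on a
   finite extension of Q. *)
HB.instance Definition _ := Topological.copy absGal
  (initial_topology
    (fun g : absGal => g : {ptws algC -> discrete_topology algC})).

Section GalK.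
Variables (K : splittingFieldType rat) (j : {rmorphism K -> algC}).

(* Gal(Qbar / K), for K seen inside Qbar through j. *)
Definition absGalK : {pred absGal} := fun g => `[< forall x, g (j x) = j x >].

Lemma absGalK_mul : mulg_closed absGalK.
Proof.
by move=> g h /asboolP gK /asboolP hK; apply/asboolP => x /=; rewrite hK.
Qed.
Lemma absGalK_1 : 1%g \in absGalK.
Proof. exact/asboolP. Qed.
Lemma absGalK_inv : invg_closed absGalK.
Proof.
by move=> g /asboolP gK; apply/asboolP => x /=; rewrite -{1}(gK x) aut_funK.
Qed.
Lemma absGalK_conj (g h : absGal) : g \in absGalK -> (g ^ h)%g \in absGalK.
Proof.
move=> /asboolP gK; apply/asboolP => x /=.
have [h0 hE] := restrict_aut_to_normal_num_field j (aut_fun h).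
by rewrite -hE gK hE aut_funK.
Qed.

HB.instance Definition _ := isMulClosed.Build absGal absGalK absGalK_mul.
HB.instance Definition _ := isMul1Closed.Build absGal absGalK absGalK_1.
HB.instance Definition _ := isInvClosed.Build absGal absGalK absGalK_inv.
HB.instance Definition _ := isNormalClosed.Build absGal absGalK absGalK_conj.

End GalK.

Section RingOfIntegers.
Variable E : fieldExtType rat.

Definition algint : {pred E} :=
  fun x => `[< integralOver (intr : int -> E) x >].

Lemma algint_subring : subring_closed algint.
Proof.
split=> [|x y /asboolP xI /asboolP yI|x y /asboolP xI /asboolP yI];
  apply/asboolP.
- exact: integral1.
- exact: integral_sub.
- exact: integral_mul.
Qed.
HB.instance Definition _ := GRing.isSubringClosed.Build E algint algint_subring.

Record ringOfInt := RingOfInt { oi_val :> E; _ : oi_val \in algint }.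
HB.instance Definition _ := [isSub for oi_val].
HB.instance Definition _ := [Choice of ringOfInt by <:].
HB.instance Definition _ := [SubChoice_isSubComNzRing of ringOfInt by <:].

End RingOfIntegers.

(* The k-th power of an ideal: I ^ (k + 1) consists of the finite sums of
   products of an element of I with an element of I ^ k. *)
Fixpoint ideal_pow (R : comNzRingType) (I : {pred R}) (k : nat) : set R :=
  if k is k'.+1 then
    [set x | exists2 s : seq (R * R),
       (forall p, p \in s -> p.1 \in I /\ ideal_pow I k' p.2) &
       x = \sum_(p <- s) p.1 * p.2]%classic
  else setT.

(* vord x is the (additive) valuation of x for x != 0; its value at 0 is
   irrelevant, as vge k x stands for k <= v(x) with v(0) = +oo. *)
Definition vge (L : fieldType) (vord : L -> int) (k : int) (x : L) : bool :=
  (x == 0) || (k <= vord x).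

HB.mixin Record Uniform_isValuedField L of GRing.Field L & PointedUniform L := {
  vord : L -> int;
  vordM : forall x y : L, x != 0 -> y != 0 -> vord (x * y) = vord x + vord y;
  vordD : forall x y : L, x != 0 -> y != 0 -> x + y != 0 ->
    Num.min (vord x) (vord y) <= vord (x + y);
  entourage_vord : @entourage L =
    filter_from setT (fun k => [set p | vge vord k (p.1 - p.2)]%classic)
}.

#[short(type="valuedFieldType")]
HB.structure Definition ValuedField :=
  {L of Uniform_isValuedField L & GRing.Field L & PointedUniform L}.

#[short(type="completeValuedFieldType")]
HB.structure Definition CompleteValuedField :=
  {L of ValuedField L & Complete L}.

(* L, with the embedding i, is the completion of E at Lam: it is complete, E is
   dense in it, and its valuation extends the Lam-adic one, for which an
   algebraic integer x has valuation at least k iff it lies in Lam ^ k. *)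
Definition is_completion (E : fieldExtType rat) (Lam : prime_idealr (ringOfInt E))
    (L : completeValuedFieldType) (i : {rmorphism E -> L}) : Prop :=
  dense (range i) /\
  forall (x : ringOfInt E) (k : nat),
    vge (@vord L) k%:Z (i (val x)) <-> ideal_pow Lam k x.

Section ValuationRing.
Variable L : valuedFieldType.
Implicit Types x y : L.

Lemma vord1 : vord (1 : L) = 0.
Proof.
apply: (addIr (vord (1 : L))).
by rewrite -vordM ?oner_neq0 // mulr1 add0r.
Qed.

Lemma vordV x : x != 0 -> vord x^-1 = - vord x.
Proof.
move=> x0; apply: (addIr (vord x)).
by rewrite -vordM ?invr_eq0 // mulVf // vord1 addNr.
Qed.

Lemma vordN x : vord (- x) = vord x.
Proof.
have [->|x0] := eqVneq x 0; first by rewrite oppr0.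
rewrite -mulN1r vordM ?oppr_eq0 ?oner_neq0 //.
suff -> : vord (-1 : L) = 0 by rewrite add0r.
have : vord (-1 : L) *+ 2 = 0.
  by rewrite mulr2n -vordM ?oppr_eq0 ?oner_neq0 // mulrNN mulr1 vord1.
by move/eqP; rewrite mulrn_eq0 => /eqP.
Qed.

Lemma vge0 k : vge vord k (0 : L).
Proof. by rewrite /vge eqxx. Qed.

Lemma vgeD k x y : vge vord k x -> vge vord k y -> vge vord k (x + y).
Proof.
rewrite /vge; have [->|x0] := eqVneq x 0; first by rewrite add0r.
have [->|y0] := eqVneq y 0; first by rewrite addr0 (negPf x0).
have [//|xy0] := eqVneq (x + y) 0 => /= kx ky.
by apply: (le_trans _ (vordD _ _ x0 y0 xy0)); rewrite le_min kx.
Qed.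

Lemma vgeN k x : vge vord k (- x) = vge vord k x.
Proof. by rewrite /vge oppr_eq0 vordN. Qed.

Lemma vgeM k l x y :
  vge vord k x -> vge vord l y -> vge vord (k + l) (x * y).
Proof.
rewrite /vge mulf_eq0; have [//|x0] := eqVneq x 0.
have [//|y0] := eqVneq y 0 => /= kx ly.
by rewrite vordM // lerD.
Qed.

Definition vint : {pred L} := vge vord 0.

Lemma vintE x : (x \in vint) = vge vord 0 x. Proof. by []. Qed.

Lemma vint_subring : subring_closed vint.
Proof.
split=> [|x y|x y]; rewrite !vintE; last 2 first.
- by move=> xI yI; rewrite vgeD // vgeN.
- by move=> xI yI; rewrite -[0]addr0 vgeM.
- by rewrite /vge vord1 lexx orbT.
Qed.
HB.instance Definition _ := GRing.isSubringClosed.Build L vint vint_subring.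

Record valRing := ValRing { vr_val :> L; _ : vr_val \in vint }.
HB.instance Definition _ := [isSub for vr_val].
HB.instance Definition _ := [Choice of valRing by <:].
HB.instance Definition _ := [SubChoice_isSubComNzRing of valRing by <:].

Definition vr_unit : {pred valRing} :=
  fun x : valRing => (val x != 0) && (vord (val x) == 0).
(* The inverse computed in L, when it is integral. *)
Definition vr_inv (x : valRing) : valRing := insubd x (val x)^-1.

Lemma vr_unitE (x : valRing) : (x \in vr_unit) = (val x != 0) && (vord (val x) == 0).
Proof. by []. Qed.

Lemma vr_mulVx : {in vr_unit, left_inverse 1 vr_inv *%R}.
Proof.
move=> x /andP[x0 /eqP vx]; apply: val_inj.
rewrite rmorphM rmorph1 /= val_insubd ifT ?mulVf //.
by rewrite vintE /vge vordV // vx oppr0 lexx orbT.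
Qed.

Lemma vr_unitPl (x y : valRing) : y * x = 1 -> x \in vr_unit.
Proof.
move=> /(congr1 val); rewrite rmorphM rmorph1 /= => yx.
have : val y * val x != 0 by rewrite yx oner_neq0.
rewrite mulf_eq0 negb_or => /andP[y0 x0].
rewrite vr_unitE x0 /=.
have /eqP : vord (val y) + vord (val x) = 0 by rewrite -vordM // yx vord1.
have := valP x; rewrite vintE /vge (negPf x0) /= => vx.
have := valP y; rewrite vintE /vge (negPf y0) /= => vy.
by rewrite paddr_eq0 // => /andP[].
Qed.

Lemma vr_inv_out : {in [predC vr_unit], vr_inv =1 id}.
Proof.
move=> x; rewrite inE /= vr_unitE negb_and negbK => xU; apply: val_inj.
rewrite val_insubd; case: ifP => //.
have [x0|x0] := eqVneq (val x) 0; first by rewrite x0 invr0.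
rewrite (negPf x0) /= in xU; rewrite vintE /vge invr_eq0 (negPf x0) /= vordV //.
have := valP x; rewrite vintE /vge (negPf x0) /= => vx.
by rewrite oppr_ge0 => xv; rewrite eq_le vx xv in xU.
Qed.

HB.instance Definition _ := GRing.ComNzRing_hasMulInverse.Build valRing
  vr_mulVx vr_unitPl vr_inv_out.

Definition vmax : {pred valRing} := fun x : valRing => vge vord 1 (val x).

Lemma vmaxE (x : valRing) : (x \in vmax) = vge vord 1 (val x). Proof. by []. Qed.

Lemma vmax_idealr : idealr_closed vmax.
Proof.
split; rewrite ?vmaxE ?rmorph0 ?vge0 //.
  by rewrite /vge rmorph1 oner_eq0 vord1.
move=> a u v; rewrite !vmaxE => uM vM; rewrite rmorphD rmorphM vgeD //.
by rewrite -[1]add0r vgeM //; exact: (valP a).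
Qed.

Lemma vmaxNunit (x : valRing) : x \notin vmax -> x \in vr_unit.
Proof.
rewrite vmaxE vr_unitE /vge negb_or => /andP[x0 vx]; rewrite x0 /=.
have := valP x; rewrite vintE /vge (negPf x0) /= => vx0.
by rewrite eq_le vx0 andbT -ltzD1 add0r ltNge.
Qed.

HB.instance Definition _ := isIdealr.Build valRing vmax vmax_idealr.

Definition residueField : Type := {ideal_quot vmax}.
HB.instance Definition _ := GRing.ComNzRing.on residueField.

Definition residue (x : valRing) : residueField := \pi_({ideal_quot vmax}) x.

Lemma residue_is_zmod_morphism : zmod_morphism residue.
Proof. by move=> x y; rewrite /residue rmorphB. Qed.
Lemma residue_is_monoid_morphism : monoid_morphism residue.
Proof. by split=> [|x y]; rewrite /residue ?rmorph1 ?rmorphM. Qed.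
HB.instance Definition _ := GRing.isZmodMorphism.Build valRing residueField
  residue residue_is_zmod_morphism.
HB.instance Definition _ := GRing.isMonoidMorphism.Build valRing residueField
  residue residue_is_monoid_morphism.

Definition rf_inv (q : residueField) : residueField :=
  if q == 0 then 0 else
  residue (generic_quotient.repr (q : {ideal_quot vmax}))^-1.

Lemma rf_mulVf (q : residueField) : q != 0 -> rf_inv q * q = 1.
Proof.
move=> q0; rewrite /rf_inv (negPf q0).
set x := generic_quotient.repr _.
have qE : q = residue x by rewrite /residue reprK.
rewrite [X in _ * X]qE -rmorphM mulVr ?rmorph1 //.
apply: vmaxNunit; apply: contra q0 => xM.
rewrite qE; apply/eqP; rewrite -(rmorph0 residue).
by apply/eqP; rewrite -Quotient.idealrBE subr0.
Qed.

Lemma rf_inv0 : rf_inv 0 = 0.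
Proof. by rewrite /rf_inv eqxx. Qed.

HB.instance Definition _ := GRing.ComNzRing_isField.Build residueField
  rf_mulVf rf_inv0.

End ValuationRing.

Section GL.
Variables (n : nat) (R : comUnitRingType).

Record GL := MkGL { glmx :> 'M[R]_n; _ : glmx \in unitmx }.
HB.instance Definition _ := [isSub for glmx].
HB.instance Definition _ := [Choice of GL by <:].

Definition gl_one : GL := MkGL (unitmx1 R n).
Lemma gl_mul_subproof (A B : GL) : val A *m val B \in unitmx.
Proof. by rewrite unitmx_mul (valP A) (valP B). Qed.
Definition gl_mul (A B : GL) : GL := MkGL (gl_mul_subproof A B).
Lemma gl_inv_subproof (A : GL) : invmx (val A) \in unitmx.
Proof. by rewrite unitmx_inv (valP A). Qed.
Definition gl_inv (A : GL) : GL := MkGL (gl_inv_subproof A).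

Lemma gl_mulA : associative gl_mul.
Proof. by move=> A B C; apply: val_inj; rewrite /= mulmxA. Qed.
Lemma gl_mul1g : left_id gl_one gl_mul.
Proof. by move=> A; apply: val_inj; rewrite /= mul1mx. Qed.
Lemma gl_mulg1 : right_id gl_one gl_mul.
Proof. by move=> A; apply: val_inj; rewrite /= mulmx1. Qed.
Lemma gl_mulVg : left_inverse gl_one gl_inv gl_mul.
Proof. by move=> A; apply: val_inj; rewrite /= mulVmx // (valP A). Qed.
Lemma gl_mulgV : right_inverse gl_one gl_inv gl_mul.
Proof. by move=> A; apply: val_inj; rewrite /= mulmxV // (valP A). Qed.

HB.instance Definition _ := isGroup.Build GL
  gl_mulA gl_mul1g gl_mulg1 gl_mulVg gl_mulgV.

Definition gl_scalar : {pred GL} := fun A => is_scalar_mx (val A).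

Lemma gl_scalar_mul : mulg_closed gl_scalar.
Proof.
move=> A B /is_scalar_mxP[a Aa] /is_scalar_mxP[b Bb].
by apply/is_scalar_mxP; exists (a * b); rewrite /= -/(val _) Aa Bb scalar_mxM.
Qed.
Lemma gl_scalar_1 : 1%g \in gl_scalar.
Proof. by apply/is_scalar_mxP; exists 1. Qed.
Lemma gl_scalar_inv : invg_closed gl_scalar.
Proof.
move=> A /is_scalar_mxP[a Aa].
by apply/is_scalar_mxP; exists a^-1; rewrite -invmx_scalar -Aa.
Qed.
Lemma gl_scalar_conj (A B : GL) : A \in gl_scalar -> (A ^ B)%g \in gl_scalar.
Proof.
move=> AS; suff -> : (A ^ B)%g = A by [].
have /is_scalar_mxP[a Aa] := AS.
suff AB : (A * B = B * A)%g by rewrite conjgE AB mulKg.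
by apply: val_inj; rewrite /= -!/(val _) Aa scalar_mxC.
Qed.

HB.instance Definition _ := isMulClosed.Build GL gl_scalar gl_scalar_mul.
HB.instance Definition _ := isMul1Closed.Build GL gl_scalar gl_scalar_1.
HB.instance Definition _ := isInvClosed.Build GL gl_scalar gl_scalar_inv.
HB.instance Definition _ := isNormalClosed.Build GL gl_scalar gl_scalar_conj.

End GL.

Definition PGL (n : nat) (F : fieldType) : groupType := gquot (@gl_scalar n F).
Definition gl_pgl (n : nat) (F : fieldType) (A : GL n F) : PGL n F := gpi _ A.

Section MapGL.
Variables (n : nat) (R S : comUnitRingType) (f : {rmorphism R -> S}).

Lemma map_gl_subproof (A : GL n R) : map_mx f (val A) \in unitmx.
Proof. by rewrite unitmxE det_map_mx rmorph_unit // -unitmxE (valP A). Qed.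
Definition map_gl (A : GL n R) : GL n S := MkGL (map_gl_subproof A).

End MapGL.

Definition pgl_red (n : nat) (L : valuedFieldType) (A : GL n (valRing L)) :
  PGL n (residueField L) := gl_pgl (map_gl (@residue L) A).

Section IntegralMatrices.
Variables (N : nat) (L : valuedFieldType) (A : absGal -> 'M[L]_N).
Hypotheses (A1 : A 1%g = 1%:M) (AM : forall g h, A (g * h)%g = A g *m A h).
Hypothesis Aint : forall g i j, A g i j \in @vint L.

Definition int_mx (g : absGal) : 'M[valRing L]_N :=
  \matrix_(i, j) ValRing (Aint g i j).

Lemma map_vr_val_inj (X Y : 'M[valRing L]_N) :
  map_mx val X = map_mx val Y -> X = Y.
Proof.
move=> /matrixP XY; apply/matrixP => i j; apply: val_inj.
by have := XY i j; rewrite !mxE.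
Qed.

Lemma val_int_mx g : map_mx val (int_mx g) = A g.
Proof. by apply/matrixP => i j; rewrite !mxE. Qed.

Lemma int_mx1 : int_mx 1%g = 1%:M.
Proof.
by apply: map_vr_val_inj; rewrite val_int_mx A1 map_mx1.
Qed.

Lemma int_mxM g h : int_mx (g * h)%g = int_mx g *m int_mx h.
Proof.
by apply: map_vr_val_inj; rewrite map_mxM !val_int_mx AM.
Qed.

Lemma int_mx_unit g : int_mx g \in unitmx.
Proof.
have /mulmx1_unit[] // : int_mx g *m int_mx g^-1%g = 1%:M.
by rewrite -int_mxM mulgV int_mx1.
Qed.

Definition int_gl (g : absGal) : GL N (valRing L) := MkGL (int_mx_unit g).

Lemma int_glM : {morph int_gl : g h / (g * h)%g}.
Proof. by move=> g h; apply: val_inj; rewrite /= int_mxM. Qed.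

End IntegralMatrices.

Definition end_mx (L : fieldType) (W : vectType L) (m : nat) (w : m.-tuple W)
  (f : 'End(W)) : 'M[L]_m := \matrix_(i, j) coord w i (f w`_j).

(* Continuity is that of the matrix of pi(g), in any basis of W. *)
Record galoisRep (L : valuedFieldType) (W : vectType L) := GaloisRep {
  gr_fun :> absGal -> 'End(W);
  gr1 : gr_fun 1%g = \1%VF;
  grM : forall g h, gr_fun (g * h)%g = (gr_fun g \o gr_fun h)%VF;
  gr_continuous : forall (m : nat) (w : m.-tuple W), basis_of fullv w ->
    continuous (fun g => end_mx w (gr_fun g))
}.

(* A Galois representation of dimension m, with a chosen basis in which its
   image lies in GL_m of the valuation ring. *)
Record integralRep (L : valuedFieldType) (W : vectType L) (m : nat) :=
  IntegralRep {
    ir_rep :> galoisRep W;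
    ir_basis : m.-tuple W;
    ir_basisP : basis_of fullv ir_basis;
    ir_int : forall g i j, end_mx ir_basis (ir_rep g) i j \in @vint L
  }.

Section Reduction.
Variables (L : valuedFieldType) (W : vectType L) (m : nat).
Variable pi : integralRep W m.
Local Notation w := (ir_basis pi).

Definition rep_mx (g : absGal) : 'M[L]_m := end_mx w (pi g).

Lemma w_free : free w.
Proof. exact: basis_free (ir_basisP pi). Qed.

Lemma w_coord v : v = \sum_i coord w i v *: w`_i.
Proof.
by apply: coord_span; rewrite (span_basis (ir_basisP pi)) memvf.
Qed.

Lemma rep_mx1 : rep_mx 1%g = 1%:M.
Proof.
by apply/matrixP => i j; rewrite !mxE gr1 id_lfunE coord_free ?w_free // eq_sym.
Qed.

Lemma rep_mxM g h : rep_mx (g * h)%g = rep_mx g *m rep_mx h.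
Proof.
apply/matrixP => i j; rewrite !mxE grM comp_lfunE.
rewrite [pi h w`_j]w_coord linear_sum linear_sum /=; apply: eq_bigr => k _.
by rewrite !linearZ /= !mxE mulrC.
Qed.

Definition rep_gl : absGal -> GL m (valRing L) :=
  int_gl rep_mx1 rep_mxM (ir_int pi).

Definition rep_red (g : absGal) : PGL m (residueField L) := pgl_red (rep_gl g).

End Reduction.

(* Right coset representatives of H; as H is normal, they are also left coset
   representatives. *)
Record cosetReps (H : {pred absGal}) (n : nat) := CosetReps {
  cr_fun :> 'I_n -> absGal;
  cr_unique : forall g, exists! i, (g * (cr_fun i)^-1)%g \in H
}.

Section Induction.
Variables (H : normalClosed absGal) (n : nat) (s : cosetReps H n).
Variables (L : valuedFieldType) (W : vectType L) (m : nat).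
Variable pi : integralRep W m.
Local Notation w := (ir_basis pi).

Definition ind_space : set (absGal -> W) :=
  [set f | forall h g, h \in H -> f (h * g)%g = pi h (f g)]%classic.

Definition ind_act (g : absGal) (f : absGal -> W) : absGal -> W :=
  fun x => f (x * g)%g.

Definition ind_phi (t : absGal) (v : W) : absGal -> W :=
  fun g => if (g * t^-1)%g \in H then pi (g * t^-1)%g v else 0.

(* The basis phi_(s_i, w_j) of V, and the coordinates of f in V on this basis;
   in both, (i, j) is encoded as mxvec_index i j. *)
Definition ind_basis (c : 'I_(n * m)) : absGal -> W :=
  mxvec (\matrix_(i < n, j < m) ind_phi (s i) w`_j) 0 c.

Definition ind_coord (f : absGal -> W) (c : 'I_(n * m)) : L :=
  mxvec (\matrix_(i < n, j < m) coord w j (f (s i))) 0 c.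

Lemma ind_basisE i j : ind_basis (mxvec_index i j) = ind_phi (s i) w`_j.
Proof. by rewrite /ind_basis mxvecE mxE. Qed.

Lemma ind_coordE f i j : ind_coord f (mxvec_index i j) = coord w j (f (s i)).
Proof. by rewrite /ind_coord mxvecE mxE. Qed.

Lemma ind_basis_space c : ind_space (ind_basis c).
Proof.
case/mxvec_indexP: c => i j; rewrite /ind_space /= => h g hH; rewrite ind_basisE /ind_phi.
rewrite -(mulgA h g) gpredMl //.
by case: ifP => _; rewrite ?grM ?comp_lfunE ?linear0.
Qed.

Lemma ind_act_space g f : ind_space f -> ind_space (ind_act g f).
Proof. by rewrite /ind_space /= => fV h x hH; rewrite /ind_act -mulgA fV. Qed.

Lemma cr_eq i k : (s i * (s k)^-1)%g \in H -> i = k.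
Proof.
move=> ik; have [l [_ lU]] := cr_unique s (s i).
by rewrite -(lU i) ?mulgV ?gpred1 // -(lU k).
Qed.

Lemma ind_coord_basis r c : ind_coord (ind_basis c) r = (r == c)%:R.
Proof.
case/mxvec_indexP: r => i j; case/mxvec_indexP: c => k l.
rewrite ind_coordE ind_basisE /ind_phi.
have -> : (mxvec_index i j == mxvec_index k l) = (i == k) && (j == l).
  have [f fK _] := curry_mxvec_bij n m.
  apply/eqP/andP => [e|[/eqP-> /eqP->]//].
  have := fK (i, j) isT; rewrite /= e (fK (k, l) isT) => -[-> ->].
  by rewrite !eqxx.
case: ifP => [/cr_eq <-|ik].
  by rewrite mulgV gr1 id_lfunE coord_free ?w_free // eqxx eq_sym.
rewrite linear0; have [e|//] := eqVneq i k.
by rewrite e mulgV gpred1 in ik.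
Qed.

Lemma ind_coord_sum f x : ind_space f ->
  f x = \sum_c ind_coord f c *: ind_basis c x.
Proof.
move=> fV; rewrite (reindex _ (curry_mxvec_bij n m)) /=.
pose F i j := ind_coord f (mxvec_index i j) *: ind_basis (mxvec_index i j) x.
rewrite (eq_bigr (fun p => F p.1 p.2)) => [|[i j] _ //]; rewrite -pair_bigA /F /=.
have [k [kH kU]] := cr_unique s x.
rewrite (bigD1 k) //= [X in _ + X]big1 ?addr0 => [|i ik].
  rewrite -[in LHS](mulgVK (s k) x) fV // [f (s k)](w_coord pi) linear_sum /=.
  apply: eq_bigr => j _.
  by rewrite ind_coordE ind_basisE /ind_phi kH linearZ.
apply: big1 => j _; rewrite ind_basisE /ind_phi ifF ?scaler0 //.
by apply: contraNF ik => /kU ->.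
Qed.

Definition ind_mx (g : absGal) : 'M[L]_(n * m) :=
  \matrix_(r, c) ind_coord (ind_act g (ind_basis c)) r.

Lemma ind_mxP g c x :
  ind_act g (ind_basis c) x = \sum_r ind_mx g r c *: ind_basis r x.
Proof.
rewrite [LHS]ind_coord_sum; first by apply: eq_bigr => r _; rewrite mxE.
exact/ind_act_space/ind_basis_space.
Qed.

Lemma ind_mx1 : ind_mx 1%g = 1%:M.
Proof.
apply/matrixP => r c; rewrite !mxE -ind_coord_basis.
by congr (ind_coord _ r); apply/funext => x; rewrite /ind_act mulg1.
Qed.

Lemma ind_mxM g h : ind_mx (g * h)%g = ind_mx g *m ind_mx h.
Proof.
apply/matrixP => r c; rewrite !mxE.
case/mxvec_indexP: r => i j; rewrite ind_coordE.
rewrite /ind_act mulgA -/(ind_act h (ind_basis c) (s i * g)%g) ind_mxP.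
rewrite linear_sum; apply: eq_bigr => k _.
by rewrite linearZ [ind_mx g _ k]mxE ind_coordE mulrC.
Qed.

Lemma ind_mx_int g r c : ind_mx g r c \in @vint L.
Proof.
rewrite mxE; case/mxvec_indexP: r => i j; case/mxvec_indexP: c => k l.
rewrite ind_coordE /ind_act ind_basisE /ind_phi.
case: ifP => _; last by rewrite linear0 rpred0.
by have := ir_int pi (s i * g * (s k)^-1)%g j l; rewrite mxE.
Qed.

Definition ind_gl : absGal -> GL (n * m) (valRing L) :=
  int_gl ind_mx1 ind_mxM ind_mx_int.

Definition ind_red (g : absGal) : PGL (n * m) (residueField L) :=
  pgl_red (ind_gl g).

End Induction.

Definition realizable (C : groupType) : Prop :=
  exists F : splittingFieldType rat, galois 1 {:F} /\
  exists f : C -> gal_of {:F}, iso_onto f [set` 'Gal({:F} / 1)%g].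

Definition realizable_through (C : finGroupType) (L : valuedFieldType)
    (W : vectType L) (m : nat) (pi : integralRep W m) : Prop :=
  exists f : C -> PGL m (residueField L), iso_onto f (range (rep_red pi)).

(* Main.v *)
From HB Require Import structures.
Require Import Defs.
From mathcomp Require Import all_boot all_order all_fingroup all_algebra all_field.
From mathcomp Require Import all_classical topology.

(** Write G for the absolute Galois group of Q, H for the normal subgroup fixing
    K, R for the reduction of the induced representation modulo Lam in PGL, and
    M for the image R(H), identified through theta.

    On H the induced matrices are block diagonal, with blocks the matrices of
    pi(s_i h s_i^-1).  Since pi is a representation of all of G, these are
    conjugates of pi(h); so one of them is scalar modulo Lam if and only if all
    of them are, with the same scalar.  Hence the reductions of rho and of pi
    have the same kernel on H ([ind_red_eq1]), whence M is also the image of H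
    under R ([iso_onto_transfer]).

    A multiplicatively closed system of representatives is the image of a
    multiplicative section sigma of G -> G/H ([cosetReps_section]), so that
    conjugation by R(sigma q) is an action of G/H on M, and
      g |-> (theta^-1 (R (g sigma(gH)^-1)), gH)
    is a morphism from G onto the semidirect product
    ([semidirect_of_section]).  Mapping G to the semidirect product, instead of
    identifying the latter with R(G), also covers m = 0, where R(G) does not
    determine the image in G/H.

    The kernel of this morphism contains the automorphisms fixing K and killed
    by the reduction of pi.  By continuity, pi(g) is congruent to 1 modulo Lam
    as soon as g fixes finitely many well chosen algebraic numbers
    ([krull_nbhs1], [rep_red_ker_open]); hence the kernel contains the fixator
    of a finite set.  By Galois theory, any quotient of G by such a kernel is
    the Galois group of a finite Galois extension of Q
    ([realizable_of_open_kernel]). *)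

Set Implicit Arguments.
Unset Strict Implicit.
Unset Printing Implicit Defensive.

Import Order.TTheory GRing.Theory Num.Theory.
Local Open Scope ring_scope.
Local Open Scope classical_set_scope.

(** * Quotients of the absolute Galois group *)

Section GroupMorphisms.
Variables (G H : groupType) (f : G -> H).
Hypothesis fM : {morph f : x y / (x * y)%g}.

Lemma morph_one : f 1%g = 1%g.
Proof. by apply: (mulgI (f 1%g)); rewrite -fM !mulg1. Qed.

Lemma morph_inv x : f x^-1%g = (f x)^-1%g.
Proof. by apply: (mulgI (f x)); rewrite -fM !mulgV morph_one. Qed.

Lemma morph_eq x y : f x = f y <-> f (x * y^-1)%g = 1%g.
Proof.
rewrite fM morph_inv; split=> [->|xy]; first by rewrite mulgV.
by rewrite -[LHS](mulgVK (f y)) xy mul1g.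
Qed.

End GroupMorphisms.

(** Field extensions of Q generated by all the roots of a rational polynomial
    can be built inside the algebraic numbers, by adjoining these roots: the
    polynomial already splits there. *)
Lemma splitting_number_field (q : {poly rat}) (rs : seq algC) :
  map_poly ratr q %= \prod_(r <- rs) ('X - r%:P) ->
  exists (F : splittingFieldType rat) (j : {rmorphism F -> algC}) (rs1 : seq F),
    map j rs1 = rs /\ <<1 & rs1>>%VS = fullv.
Proof.
move=> q_rs; have [F [j [rs1 j_rs1 F_rs1]]] := num_field_exists rs.
have axF : SplittingField.axiom F.
  exists (map_poly (in_alg F) q).
    by apply/polyOverP=> k; rewrite coef_map /= memvZ ?mem1v.
  exists rs1 => //; rewrite -(eqp_map j) -map_poly_comp.
  have -> : map_poly (j \o in_alg F) q = map_poly ratr q.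
    by apply: eq_map_poly => a /=; rewrite alg_num_field fmorph_rat.
  rewrite (eqp_trans q_rs) // rmorph_prod -j_rs1 big_map /=.
  by rewrite (eq_bigr _ (fun r _ => map_polyXsubC j r)) eqpxx.
pose N : splittingFieldType rat :=
  HB.pack (FieldExt.sort F) (FieldExt_isSplittingField.Build rat F axF).
by exists N, j, rs1.
Qed.

Section Restriction.
Variables (F : splittingFieldType rat) (j : {rmorphism F -> algC}).

Lemma gal_restrict (g : absGal) :
  exists x : gal_of {:F}, forall a, j (x a) = g (j a).
Proof.
have [g0 jg0] := restrict_aut_to_normal_num_field j (aut_fun g).
have [|x _ gx] := @kAut_to_gal _ F 1%AS {:F}%AS (linfun g0).
  rewrite kAutfE k1HomE; apply/ahomP_tmp.
  split=> [|a b]; first by rewrite lfunE /= rmorph1.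
  by rewrite !lfunE /= rmorphM.
by exists x => a; rewrite -jg0 -gx ?memvf // lfunE.
Qed.

(** An embedding extending [x] to the algebraic numbers is invertible, since it
    permutes the finitely many roots of each rational polynomial. *)
Lemma gal_extend (x : gal_of {:F}) :
  exists g : absGal, forall a, g (j a) = j (x a).
Proof.
have [nu nu_x] := extend_algC_subfield_aut j x.
by exists (AbsGal (algC_autK nu) (algC_invautK nu)) => a /=; rewrite nu_x.
Qed.

(** Products in [gal_of] are in diagrammatic order whereas [absGal] composes
    functions; restricting the inverse of [g] turns this into a morphism. *)
Definition gal_res (g : absGal) : gal_of {:F} := sval (cid (gal_restrict g^-1%g)).

Lemma gal_resE g a : j (gal_res g a) = aut_inv g (j a).
Proof. by rewrite /gal_res; case: cid. Qed.

Lemma gal_resP g (x : gal_of {:F}) :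
  (forall a, aut_inv g (j a) = j (x a)) -> gal_res g = x.
Proof.
by move=> gx; apply/eqP/gal_eqP=> a _; apply: (fmorph_inj j); rewrite gal_resE gx.
Qed.

Lemma gal_resM : {morph gal_res : g h / (g * h)%g}.
Proof. by move=> g h; apply: gal_resP => a; rewrite galM ?memvf // !gal_resE. Qed.

Lemma gal_res_surj x : exists g, gal_res g = x.
Proof.
by have [g gx] := gal_extend x; exists g^-1%g; apply: gal_resP => a; rewrite -gx.
Qed.

Lemma gal_res_eq1 g : gal_res g = 1%g <-> g \in absGalK j.
Proof.
rewrite -gpredV; split=> [g1|/asboolP g1].
  by apply/asboolP => a; rewrite -gal_resE g1 gal_id.
by apply: gal_resP => a; rewrite gal_id g1.
Qed.

End Restriction.

Lemma galois_rat (F : splittingFieldType rat) : galois 1 {:F}.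
Proof.
apply/and3P; rewrite sub1v normalFieldf; split=> //; apply/separableP => x _.
exact/pcharf0_separable/(ftrans (pchar_lalg F) (pchar_num _)).
Qed.

(** [Phi] and restriction to [F] are surjections with the same kernel, so their
    targets are isomorphic: a preimage under [Phi] is chosen and restricted. *)
Lemma realizable_of_kernel (C : groupType) (Phi : absGal -> C)
    (F : splittingFieldType rat) (j : {rmorphism F -> algC}) :
  {morph Phi : g h / (g * h)%g} -> (forall c, exists g, Phi g = c) ->
  (forall g, Phi g = 1%g <-> g \in absGalK j) -> realizable C.
Proof.
move=> PhiM Phi_surj kerPhi.
have eq_res g h : Phi g = Phi h <-> gal_res j g = gal_res j h.
  by rewrite (morph_eq PhiM) (morph_eq (gal_resM j)) gal_res_eq1.
exists F; split; first exact: galois_rat.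
pose pre c := sval (cid (Phi_surj c)).
have preK c : Phi (pre c) = c by rewrite /pre; case: cid.
exists (fun c => gal_res j (pre c)); split.
- by move=> c d; rewrite -gal_resM; apply/eq_res; rewrite PhiM !preK.
- by move=> c d /eq_res; rewrite !preK.
- apply/seteqP; split=> x /= _; first by rewrite gal_kHom ?sub1v // k1AHom.
  have [g gx] := gal_res_surj j x.
  by exists (Phi g) => //; rewrite -gx; apply/eq_res; rewrite preK.
Qed.

(** The field is generated by all the conjugates of the elements of [s], i.e. by
    the roots of the product [q] of their minimal polynomials over Q. *)
Lemma number_field_contains (s : seq algC) :
  exists (N : splittingFieldType rat) (j : {rmorphism N -> algC}),
    forall z, z \in s -> exists a, j a = z.
Proof.
have [q q0 qs] : exists2 q : {poly rat}, q != 0 &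
    forall z, z \in s -> root (map_poly (ratr : rat -> algC) q) z.
  elim: s => [|z s [q q0 qs]]; first by exists 1; rewrite ?oner_eq0.
  have [p [_ p_mon] p_z] := minCpolyP z.
  exists (p * q); first exact: mulf_neq0 (monic_neq0 p_mon) q0.
  move=> y; rewrite inE rmorphM /= rootM.
  by case/predU1P=> [->|/qs->]; rewrite ?orbT // p_z dvdpp.
have [rs q_rs] := closed_field_poly_normal (map_poly (ratr : rat -> algC) q).
have lq0 : lead_coef (map_poly (ratr : rat -> algC) q) != 0.
  by rewrite lead_coef_eq0 map_poly_eq0.
have [|N [j [rs1 [j_rs1 _]]]] := @splitting_number_field q rs.
  by rewrite q_rs eqp_scale.
exists N, j => z /qs; rewrite q_rs rootZ // root_prod_XsubC -j_rs1.
by case/mapP=> a _ ->; exists a.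
Qed.

Section Adjunction.
Variables (F : splittingFieldType rat) (j : {rmorphism F -> algC}).

Lemma gal_res_adjoin (rs : seq F) (g : absGal) :
  gal_res j g \in 'Gal({:F} / <<1 & rs>>%VS)%g <-> {in map j rs, forall z, g z = z}.
Proof.
rewrite gal_kHom ?subvf // /kHom [ahom_in _ _]ahomWin /=.
split=> [/Fadjoin_seqP[_ rs_fix] _ /mapP[a /rs_fix/fixedSpaceP ga ->]|rs_fix].
  by rewrite -{1}ga gal_resE aut_invK.
apply/Fadjoin_seqP; rewrite sub1v; split=> // a /(map_f j)/rs_fix ga.
by apply/fixedSpaceP/(fmorph_inj j); rewrite gal_resE -{1}ga aut_funK.
Qed.

Lemma absGalK_gen (rs : seq F) (g : absGal) : <<1 & rs>>%VS = fullv ->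
  g \in absGalK j <-> {in map j rs, forall z, g z = z}.
Proof.
move=> F_rs; rewrite -gal_res_eq1 -gal_res_adjoin F_rs.
split=> [->|]; first exact: group1.
rewrite gal_kHom ?subvf // => /andP[_ /fixedSpacesP g_id].
by apply/eqP/gal_eqP=> a Fa; rewrite gal_id g_id.
Qed.

End Adjunction.

(** A normal number field [N] containing [s] is such that [Phi] factors through
    restriction to [N].  The image [A] of the kernel of [Phi] is then normal in
    Gal(N/Q), and the subfield fixed by [A] is the field sought: by Artin's
    theorem, an element of Gal(N/Q) fixes it exactly when it lies in [A].  This
    subfield, the splitting field of some rational polynomial [q], is rebuilt as
    a type of its own [F] by adjoining to Q the same roots. *)
Lemma realizable_of_open_kernel (C : groupType) (Phi : absGal -> C) (s : seq algC) :
  {morph Phi : g h / (g * h)%g} -> (forall c, exists g, Phi g = c) ->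
  (forall g : absGal, {in s, forall z, g z = z} -> Phi g = 1%g) -> realizable C.
Proof.
move=> PhiM Phi_surj kerPhi.
have [N [j Ns]] := number_field_contains s.
have kerN g : gal_res j g = 1%g -> Phi g = 1%g.
  move/gal_res_eq1/asboolP=> gN; apply: kerPhi => z /Ns[a <-]; exact: gN.
pose A := [set x : gal_of {:N} | `[< exists2 g, Phi g = 1%g & gal_res j g = x >]]%SET.
(* A g' in ker Phi with the restriction of g differs from g by an element
   fixing N, hence killed by Phi. *)
have AP g : (gal_res j g \in A) = (Phi g == 1%g).
  rewrite inE; apply/asboolP/eqP => [[h h1 gh]|]; last by exists g.
  by rewrite -h1; apply/(morph_eq PhiM)/kerN/(morph_eq (gal_resM j)).
have res1 := morph_one (gal_resM j); have resV := morph_inv (gal_resM j).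
have Phi1 := morph_one PhiM; have PhiV := morph_inv PhiM.
have Agrp : group_set A.
  apply/group_setP; split=> [|x y]; first by rewrite -res1 AP Phi1.
  have [g <-] := gal_res_surj j x; have [h <-] := gal_res_surj j y.
  by rewrite -gal_resM !AP PhiM => /eqP-> /eqP->; rewrite mul1g.
pose GA := Group Agrp.
have nA : (GA <| 'Gal({:N} / 1%AS))%g.
  apply/andP; split.
    by apply/fintype.subsetP => x _; rewrite gal_kHom ?sub1v // k1AHom.
  apply/fintype.subsetP => y _; have [h <-] := gal_res_surj j y.
  rewrite inE; apply/fintype.subsetP => _ /imsetP[x xA ->].
  move: xA; have [g <-] := gal_res_surj j x.
  rewrite /= conjgE -resV -!gal_resM !AP !PhiM => /eqP->.
  by rewrite mul1g PhiV mulVg.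
have /splitting_galoisField[p [p_rat _ [rs p_rs Frs]]] :=
  normal_fixedField_galois (galois_rat N) nA.
have /polyOver1P[q qp] := p_rat.
have [|F [j' [rs1 [j_rs1 F_rs1]]]] := @splitting_number_field q (map j rs).
  have -> : map_poly ratr q = map_poly j p.
    rewrite qp -map_poly_comp; apply: eq_map_poly => a /=.
    by rewrite alg_num_field fmorph_rat.
  rewrite big_map; move: p_rs; rewrite -(eqp_map j) rmorph_prod /=.
  by rewrite (eq_bigr _ (fun r _ => map_polyXsubC j r)).
apply: (realizable_of_kernel PhiM Phi_surj (j := j')) => g.
have -> : Phi g = 1%g <-> gal_res j g \in (GA : {set _}).
  by rewrite AP; split=> /eqP.
by rewrite -(gal_fixedField GA) -Frs (absGalK_gen _ _ F_rs1) j_rs1 gal_res_adjoin.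
Qed.

(** * Continuity of the representation *)

(** The sets of functions fixing a finite set are a base of a filter which
    converges to the identity: this is checked one coordinate at a time, where
    a single fixed point is enough. *)
Lemma krull_nbhs1 (U : set absGal) : nbhs (1%g : absGal) U ->
  exists s : seq algC, forall g : absGal, {in s, forall z, g z = z} -> U g.
Proof.
pose T : topologicalType := {ptws algC -> discrete_topology algC}.
pose fixing (s : seq algC) : set T := [set f | {in s, forall z, f z = z}].
pose Phi : set_system T := filter_from setT fixing.
have PhiF : Filter Phi.
  apply: filter_from_filter => [|s t _ _]; first by exists [::].
  exists (s ++ t) => // f st.
  by split=> z zs; apply: st; rewrite mem_cat zs ?orbT.
have Phi1 : Phi --> (idfun : T).
  apply/cvg_sup => z V [_ [[O oO <-] Oz] OV].
  exists [:: z] => // f fz; apply: OV => /=.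
  by rewrite /proj fz ?mem_head.
move=> [_ [[O oO <-] O1] OU].
have [s _ sO] := Phi1 O (open_nbhs_nbhs (conj oO O1)).
by exists s => g gs; apply: OU; apply: sO.
Qed.

Section Reduction.
Variables (L : valuedFieldType) (n : nat).
Implicit Types A B : GL n (valRing L).

Lemma pgl_redM : {morph @pgl_red n L : A B / (A * B)%g}.
Proof.
move=> A B; rewrite /pgl_red /gl_pgl -gpi_morph; congr (gpi _ _).
by apply: val_inj; rewrite /= map_mxM.
Qed.

Lemma pgl_red_eq1 A :
  pgl_red A = 1%g <-> is_scalar_mx (map_mx (@residue L) (val A)).
Proof.
apply: (iff_trans (gpiP _ _ _)).
by rewrite invg1 mulg1.
Qed.

Lemma residue_eq (x y : valRing L) :
  residue x = residue y <-> vge (@vord L) 1 (val x - val y).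
Proof.
rewrite -rmorphB -[vge _ _ _]/(x - y \in @vmax L) Quotient.idealrBE.
by split=> /eqP.
Qed.

Lemma val_int_gl (X : absGal -> 'M[L]_n) X1 XM Xint (g : absGal) r c :
  val (val (@int_gl n L X X1 XM Xint g) r c) = X g r c.
Proof. by rewrite mxE. Qed.

Lemma nbhs_vge k (x : L) : nbhs x [set y | vge (@vord L) k (x - y)].
Proof.
rewrite -nbhs_entourageE; exists [set p : L * L | vge (@vord L) k (p.1 - p.2)].
  by rewrite entourage_vord; exists k.
by move=> y /xsectionP.
Qed.

End Reduction.

Section Representation.
Variables (L : valuedFieldType) (W : vectType L) (m : nat) (pi : integralRep W m).

Lemma rep_redM : {morph rep_red pi : g h / (g * h)%g}.
Proof. by move=> g h; rewrite /rep_red [rep_gl _ _]int_glM pgl_redM. Qed.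

(** The matrices congruent to 1 modulo the maximal ideal form a neighbourhood
    of 1, so they contain the matrix of [pi g] for all [g] close to 1. *)
Lemma rep_red_ker_open :
  exists s : seq algC, forall g : absGal, {in s, forall z, g z = z} ->
    rep_red pi g = 1%g.
Proof.
pose U := [set A : 'M[L]_m | forall i j, vge (@vord L) 1 (rep_mx pi 1%g i j - A i j)].
have nU : nbhs (rep_mx pi 1%g) U.
  exists (fun i j => [set y | vge (@vord L) 1 (rep_mx pi 1%g i j - y)]) => // i j.
  exact: nbhs_vge.
have [s sU] := krull_nbhs1 (gr_continuous (ir_basisP pi) nU).
exists s => g /sU gU; apply/pgl_red_eq1/is_scalar_mxP; exists (residue 1).
rewrite -(map_scalar_mx (@residue L)) -(int_mx1 (rep_mx1 pi) (@ir_int _ _ _ pi)).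
apply/esym/matrixP => i j; rewrite ![map_mx _ _ i j]mxE; apply/residue_eq.
by rewrite [int_mx _ _ i j]mxE val_int_gl; apply: gU.
Qed.

End Representation.

(** * The induced representation on the normal subgroup *)

Lemma mxvec_index_eq m n (i k : 'I_m) (a b : 'I_n) :
  (mxvec_index i a == mxvec_index k b) = (i == k) && (a == b).
Proof.
have [f fK _] := curry_mxvec_bij m n.
apply/eqP/andP => [e|[/eqP-> /eqP->]//].
have := fK (i, a) isT; rewrite /= e (fK (k, b) isT) => -[-> ->].
by rewrite !eqxx.
Qed.

Section Induced.
Variables (H : normalClosed absGal) (n : nat) (s : cosetReps H n).
Variables (L : valuedFieldType) (W : vectType L) (m : nat) (pi : integralRep W m).

Lemma ind_redM : {morph ind_red s pi : g h / (g * h)%g}.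
Proof. by move=> g h; rewrite /ind_red [ind_gl _ _ _]int_glM pgl_redM. Qed.

(** As [H] is normal, [s i * h] lies in the coset of [s i], so that [h] permutes
    the blocks trivially. *)
Lemma ind_mx_diag h i k a b : h \in H ->
  ind_mx s pi h (mxvec_index i a) (mxvec_index k b) =
    if i == k then rep_mx pi (s i * h * (s i)^-1)%g a b else 0.
Proof.
move=> hH; rewrite mxE ind_coordE /ind_act ind_basisE /ind_phi.
have shH : (s i * h * (s i)^-1)%g \in H.
  by have := gpredJr h (s i)^-1%g hH; rewrite conjgE invgK mulgA.
have -> : (s i * h * (s k)^-1)%g =
    (s i * h * (s i)^-1 * (s i * (s k)^-1))%g by rewrite !mulgA mulgVK.
rewrite gpredMl //; have [<-|ik] := eqVneq i k.
  by rewrite mulgV gpred1 mulg1 [RHS]mxE.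
by rewrite ifF ?linear0 //; apply: contraNF ik => /cr_eq->.
Qed.

Lemma residue_ind_diag h i k a b : h \in H ->
  map_mx (@residue L) (val (ind_gl s pi h)) (mxvec_index i a) (mxvec_index k b) =
    if i == k then map_mx (@residue L) (val (rep_gl pi (s i * h * (s i)^-1)%g)) a b
    else 0.
Proof.
move=> hH; rewrite mxE; case: (eqVneq i k) (ind_mx_diag i k a b hH) => _ diag.
  by rewrite [RHS]mxE; congr residue; apply: val_inj; rewrite !val_int_gl.
by rewrite -(rmorph0 (@residue L)); congr residue; apply: val_inj; rewrite val_int_gl.
Qed.

(** Conjugating a scalar does not change it; the point is that [g] ranges over
    the whole Galois group, on which [pi] is defined. *)
Lemma rep_residue_conj g h c :
  map_mx (@residue L) (val (rep_gl pi h)) = c%:M ->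
  map_mx (@residue L) (val (rep_gl pi (g * h * g^-1)%g)) = c%:M.
Proof.
pose bar g := map_gl (@residue L) (rep_gl pi g).
have barM : {morph bar : g h / (g * h)%g}.
  move=> x y; apply: val_inj.
  by rewrite /bar [rep_gl _ _]int_glM /= map_mxM.
rewrite -![map_mx _ _]/(val (bar _)) => hc; rewrite -hc; congr val.
have gh : (bar g * bar h = bar h * bar g)%g.
  apply: val_inj.
  by rewrite -[LHS]/(val (bar g) *m val (bar h)) hc scalar_mxC -hc.
by rewrite !barM gh -mulgA -barM mulgV (morph_one barM) mulg1.
Qed.

(** All diagonal blocks of the induced matrix are conjugates of the reduction
    of [pi h], so the whole matrix is the scalar [c] iff the latter is. *)
Lemma ind_red_eq1 h : h \in H -> ind_red s pi h = 1%g <-> rep_red pi h = 1%g.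
Proof.
move=> hH; rewrite !pgl_red_eq1.
split=> /is_scalar_mxP[c hc]; apply/is_scalar_mxP; exists c.
  have [i _] := cr_unique s 1%g.
  have -> : h = ((s i)^-1 * (s i * h * (s i)^-1) * (s i)^-1^-1)%g.
    by rewrite invgK !mulgA mulVg mul1g mulgVK.
  apply: rep_residue_conj; apply/matrixP=> a b.
  have := residue_ind_diag i i a b hH; rewrite eqxx hc => <-.
  by rewrite !mxE mxvec_index_eq eqxx.
apply/matrixP=> r t; case/mxvec_indexP: r => i a; case/mxvec_indexP: t => k b.
rewrite residue_ind_diag // (rep_residue_conj _ hc) !mxE mxvec_index_eq.
by case: eqP.
Qed.

End Induced.

(** * Semidirect products from multiplicative sections *)
Section Groups.
Variables (G : groupType) (N : normalClosed G).

(** [R] and [R'] have the same kernel on [N], so [R h |-> R' h] is a well-defined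
    isomorphism from [R N] to [R' N]; it is composed with [f]. *)
Lemma iso_onto_transfer (A P P' : groupType) (R : G -> P) (R' : G -> P') (f : A -> P) :
  {morph R : x y / (x * y)%g} -> {morph R' : x y / (x * y)%g} ->
  (forall h, h \in N -> R h = 1%g <-> R' h = 1%g) ->
  iso_onto f (R @` [set` N]) -> exists f' : A -> P', iso_onto f' (R' @` [set` N]).
Proof.
move=> RM R'M kerRR' [fM f_inj f_im].
have RR' h k : h \in N -> k \in N -> R h = R k <-> R' h = R' k.
  move=> hN kN; rewrite (morph_eq RM) (morph_eq R'M); apply: kerRR'.
  by rewrite gpredM ?gpredV.
have pre_ex a : exists h, h \in N /\ R h = f a.
  have : range f (f a) by exists a.
  by rewrite f_im => -[h /= hN hfa]; exists h.
pose pre a := sval (cid (pre_ex a)).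
have preN a : pre a \in N by rewrite /pre; case: cid => h [].
have preR a : R (pre a) = f a by rewrite /pre; case: cid => h [].
exists (R' \o pre); split.
- move=> a b /=; rewrite -R'M; apply/RR'; rewrite ?gpredM //.
  by rewrite RM !preR fM.
- by move=> a b /= /RR' -/(_ (preN a) (preN b)); rewrite !preR => /f_inj.
- apply/seteqP; split=> [_ [a _ <-]|_ [h hN <-]] /=; first by exists (pre a) => //=.
  have : (R @` [set` N]) (R h) by exists h.
  rewrite -f_im => -[a _ fa]; exists a => //=.
  by apply/RR' => //; rewrite preR.
Qed.

(** The section splits each [g] as [h * sigma q], with [h] in [N] and [q] the
    class of [g]; [Phi] applies the inverse of [theta] to [R h] and keeps [q]. *)
Lemma semidirect_of_section (A P : groupType) (R : G -> P) (theta : A -> P)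
    (sigma : gquot N -> G) :
  {morph R : x y / (x * y)%g} -> iso_onto theta (R @` [set` N]) ->
  {morph sigma : p q / (p * q)%g} -> cancel sigma (gpi N) ->
  exists act : autAction (gquot N) A,
    (forall q x, theta (act q x) = (R (sigma q) * theta x * (R (sigma q))^-1)%g) /\
    exists Phi : G -> semidirect act,
      [/\ {morph Phi : x y / (x * y)%g}, forall c, exists g, Phi g = c &
          forall h, h \in N -> R h = 1%g -> Phi h = 1%g].
Proof.
move=> RM [thetaM theta_inj theta_im] sigmaM sigmaK.
have RV := morph_inv RM; have sigma1 := morph_one sigmaM.
have theta1 := morph_one thetaM.
have inN a : exists2 h, h \in N & R h = theta a.
  have : range theta (theta a) by exists a.
  by rewrite theta_im => -[h /= hN ha]; exists h.
have ofN h : h \in N -> exists a, theta a = R h.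
  move=> hN; have : (R @` [set` N]) (R h) by exists h.
  by rewrite -theta_im => -[a _ ha]; exists a.
have act_ex q a : exists b, theta b = (R (sigma q) * theta a * (R (sigma q))^-1)%g.
  have [h hN <-] := inN a; rewrite -RV -!RM; apply: ofN.
  by have := gpredJr h (sigma q)^-1%g hN; rewrite conjgE invgK mulgA.
pose act q a := sval (cid (act_ex q a)).
have actE q a : theta (act q a) = (R (sigma q) * theta a * (R (sigma q))^-1)%g.
  by rewrite /act; case: cid.
have act1 a : act 1%g a = a.
  by apply: theta_inj; rewrite actE sigma1 (morph_one RM) invg1 mulg1 mul1g.
have actM p q a : act (p * q)%g a = act p (act q a).
  by apply: theta_inj; rewrite !actE sigmaM RM invgM !mulgA.
have act_morph q : {morph act q : a b / (a * b)%g}.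
  move=> a b; apply: theta_inj.
  by rewrite thetaM !actE thetaM !mulgA mulgVK.
have phi_ex g : exists a, theta a = R (g * (sigma (gpi N g))^-1)%g.
  by apply: ofN; apply/gpiP; rewrite sigmaK.
pose phi g := sval (cid (phi_ex g)).
have phiE g : theta (phi g) = R (g * (sigma (gpi N g))^-1)%g.
  by rewrite /phi; case: cid.
pose actN := AutAction act1 actM act_morph.
exists actN; split=> //.
exists (fun g => (phi g, gpi N g) : semidirect actN); split.
- move=> g h; congr pair; last exact: gpi_morph.
  apply: theta_inj; rewrite /= thetaM actE !phiE gpi_morph sigmaM -RV -!RM.
  by rewrite invgM !mulgA mulgVK.
- case=> a q; have [h hN ha] := inN a; exists (h * sigma q)%g.
  have hq : gpi N (h * sigma q)%g = q.
    rewrite gpi_morph sigmaK -[RHS]mul1g; congr (_ * _)%g.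
    by apply/gpiP; rewrite invg1 mulg1.
  by congr pair => //; apply: theta_inj; rewrite phiE hq mulgK.
- move=> h hN Rh1; have h1 : gpi N h = 1%g by apply/gpiP; rewrite invg1 mulg1.
  congr pair => //; apply: theta_inj.
  by rewrite phiE h1 sigma1 invg1 mulg1 theta1.
Qed.

End Groups.

(** Each class contains a single representative, and the product of the
    representatives of [p] and [q], being itself a representative, is the one of
    [p * q]. *)
Lemma cosetReps_section (H : normalClosed absGal) n (s : cosetReps H n) :
  (forall a b, exists c, (s a * s b)%g = s c) ->
  exists sigma : gquot H -> absGal,
    [/\ {morph sigma : p q / (p * q)%g}, cancel sigma (gpi H) &
        forall a, sigma (gpi H (s a)) = s a].
Proof.
move=> s_mul.
have gpi_inj a b : gpi H (s a) = gpi H (s b) -> a = b by move/gpiP/cr_eq.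
have idx_ex q : exists a, gpi H (s a) = q.
  have [a [aH _]] := cr_unique s (generic_quotient.repr q).
  by exists a; rewrite -[RHS]gpi_repr; apply/esym/gpiP.
pose idx q := sval (cid (idx_ex q)).
have idxK q : gpi H (s (idx q)) = q by rewrite /idx; case: cid.
exists (s \o idx); split=> [p q|q|a] //=; last by congr (s _); apply: gpi_inj.
have [c pq] := s_mul (idx p) (idx q); rewrite pq; congr (s _); apply: gpi_inj.
by rewrite -pq gpi_morph !idxK.
Qed.

(** * Realization of the semidirect product *)

Theorem theorem3p8
  (E : fieldExtType rat)
  (Lam : prime_idealr (ringOfInt E)) (Lam_neq0 : exists2 x, x \in Lam & x != 0)
  (L : completeValuedFieldType) (i : {rmorphism E -> L})
  (L_completion : is_completion Lam i)
  (K : splittingFieldType rat) (K_galois : galois 1 {:K})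
  (j : {rmorphism K -> algC})
  (n : nat) (s : cosetReps (absGalK j) n)
  (s_mul_closed : forall a b, exists c, (s a * s b)%g = s c)
  (m : nat) (W : vectType L) (pi : integralRep W m)
  (M : finGroupType) (M_realizable : realizable_through M pi)
  (pi_G_eq_pi_H : range (rep_red pi) = rep_red pi @` [set` absGalK j]) :
  (exists theta : M -> PGL (n * m) (residueField L),
      iso_onto theta (ind_red s pi @` [set` absGalK j])) /\
  forall theta : M -> PGL (n * m) (residueField L),
    iso_onto theta (ind_red s pi @` [set` absGalK j]) ->
    exists act : autAction (gquot (absGalK j)) M,
      (forall a x, theta (act (gpi (absGalK j) (s a)) x) =
         (ind_red s pi (s a) * theta x * (ind_red s pi (s a))^-1)%g) /\
      realizable (semidirect act).
Proof.
split=> [|theta theta_iso].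
  have [f] := M_realizable; rewrite pi_G_eq_pi_H.
  apply: iso_onto_transfer; [exact: rep_redM|exact: ind_redM|].
  by move=> h hH; apply: iff_sym; apply: ind_red_eq1.
have [sigma [sigmaM sigmaK sigmaE]] := cosetReps_section s_mul_closed.
have [act [actE [Phi [PhiM Phi_surj Phi1]]]] :=
  semidirect_of_section (@ind_redM _ _ s _ _ _ pi) theta_iso sigmaM sigmaK.
exists act; split=> [a x|]; first by rewrite actE sigmaE.
have [t pi_t] := rep_red_ker_open pi.
have [p _ [rs _ K_rs]] := splittingPoly K.
apply: (realizable_of_open_kernel (s := t ++ map j rs) PhiM Phi_surj) => g g_fix.
have gH : g \in absGalK j.
  by apply/(absGalK_gen _ _ K_rs) => z z_rs; apply: g_fix; rewrite mem_cat z_rs orbT.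
apply: Phi1 => //; apply/ind_red_eq1 => //; apply: pi_t => z z_t.
by apply: g_fix; rewrite mem_cat z_t.
Qed.
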